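(* Let $n\ge0$, $k\ge1$ and $m\ge0$ be integers. The points $(J_{n+2ik},J_{n+(2i+1)k})$ for $i=0,1,\dots,m$ are collinear, and the points $(j_{n+2ik},j_{n+(2i+1)k})$ for $i=0,1,\dots,m$ are collinear.
   Context: $J_n=\frac13\left(2^n-(-1)^n\right)$ are the Jacobsthal numbers and $j_n=2^n+(-1)^n$ are the Jacobsthal–Lucas numbers. *)

(* Defs.v *)
From mathcomp Require Import all_boot all_order all_algebra.

Set Implicit Arguments.
Unset Strict Implicit.
Unset Printing Implicit Defensive.

Import Order.TTheory GRing.Theory Num.Theory.
Local Open Scope ring_scope.

Definition jacobsthal (R : realFieldType) (n : nat) : R :=
  3^-1 * (2 ^+ n - (-1) ^+ n).

Definition jacobsthal_lucas (R : realFieldType) (n : nat) : R :=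
  2 ^+ n + (-1) ^+ n.

(* A family of points of the plane is collinear if a single line
   a x + b y = c contains all of them; (a, b) <> (0, 0) makes the equation
   that of a genuine line. The points need not be pairwise distinct. *)
Definition collinear (R : realFieldType) (I : Type) (P : I -> R * R) : Prop :=
  exists a b c : R, (a, b) <> (0, 0) /\
    forall i : I, a * (P i).1 + b * (P i).2 = c.

(* Main.v *)
(** Both sequences have the form u_l = A 2^l + B (-1)^l. Passing from u_l to
    u_(l+k) multiplies the first term by 2^k, so 2^k u_l - u_(l+k) equals
    B (-1)^l (2^k - (-1)^k), which depends only on the parity of l. As
    l = n + 2ik keeps the parity of n, all points lie on the line
    2^k x - y = B (-1)^n (2^k - (-1)^k). *)
Require Import Defs.
From mathcomp Require Import all_boot all_order all_algebra.
From mathcomp Require Import ring.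

Import GRing.Theory.

(** Covers both sequences at once, with [p] equal to 2. The index map [e] can be arbitrary because
    only the evenness of [2 * e i * k] matters. *)
Lemma collinear_geometric_sign (R : realFieldType) (I : Type) (e : I -> nat)
    (u : nat -> R) (A B p : R) (n k : nat) :
  (forall l, u l = A * p ^+ l + B * (-1) ^+ l)%R ->
  collinear (fun i : I => (u (n + 2 * e i * k), u (n + (2 * e i + 1) * k))).
Proof.
move=> uE; exists (p ^+ k)%R, (-1)%R, (B * (-1) ^+ n * (p ^+ k - (-1) ^+ k))%R.
split=> [[_ /eqP]|i /=]; first by rewrite oppr_eq0 oner_eq0.
have signE : ((-1) ^+ (n + 2 * e i * k) = (-1) ^+ n :> R)%R.
  by rewrite exprD -mulnA exprM sqrrN !expr1n mulr1.
(* Only the final [k] is split off the exponents, so the powers of [p] with exponent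
   [n + 2 * e i * k] stay whole and cancel. *)
rewrite mulnDl mul1n addnA !uE !(exprD _ (n + _)) signE.
ring.
Qed.

Theorem theorem2p7 (R : realFieldType) (n k m : nat) (hk : (1 <= k)%N) :
  collinear (fun i : 'I_m.+1 =>
    (jacobsthal R (n + 2 * i * k), jacobsthal R (n + (2 * i + 1) * k))) /\
  collinear (fun i : 'I_m.+1 =>
    (jacobsthal_lucas R (n + 2 * i * k),
     jacobsthal_lucas R (n + (2 * i + 1) * k))).
Proof.
split.
(* The coefficients come from distributing the factor 1/3 over the difference. *)
- apply: (@collinear_geometric_sign _ _ _ _ 3^-1 (- 3^-1) 2)%R => l.
  by rewrite /jacobsthal mulrBr mulNr.
- apply: (@collinear_geometric_sign _ _ _ _ 1 1 2)%R => l.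
  by rewrite /jacobsthal_lucas !mul1r.
Qed.
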